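(* Let $Y$ be a strictly monotone Banach lattice and let $L$ be a locally compact Hausdorff topological space that contains at least two elements. If the pair $(C_0(L),Y)$ has the Bishop-Phelps-Bollobás property for positive operators, then $Y$ is uniformly monotone.
   Context: Banach lattices are real. $C_0(L)$ is the Banach lattice of real-valued continuous functions on $L$ vanishing at infinity, with the supremum norm and pointwise order. For Banach spaces $X,Y$: $S_X$ is the unit sphere of $X$, and $L(X,Y)$ is the space of bounded linear operators from $X$ to $Y$ with the operator norm. An operator $S$ between Banach lattices is positive ($S\ge 0$) if $S(x)\ge 0$ whenever $x\ge 0$; $X^+$ is the set of elements $x\ge 0$ of $X$. Bishop-Phelps-Bollobás property for positive operators: for Banach lattices $X,Y$, the pair $(X,Y)$ has this property if for every $0<\varepsilon<1$ there exists $0<\eta(\varepsilon)<\varepsilon$ such that for every positive $S\in S_{L(X,Y)}$, if $x_0\in S_X$ satisfies $\|S(x_0)\|>1-\eta(\varepsilon)$, then there exist $u_0\in S_X$ and a positive operator $T\in S_{L(X,Y)}$ with $\|T(u_0)\|=1$, $\|u_0-x_0\|<\varepsilon$ and $\|T-S\|<\varepsilon$. Strict monotonicity: a Banach lattice $Y$ is strictly monotone if for all $x,y\in Y^+$ with $x\le y$ and $x\ne y$ one has $\|x\|<\|y\|$. Uniform monotonicity: a Banach lattice $Y$ is uniformly monotone if for every $0<\varepsilon<1$ there is $0<\delta\le\varepsilon$ such that for all $x,y\in Y^+$ with $\|x\|=1$ and $\|x+y\|\le 1+\delta$ one has $\|y\|\le\varepsilon$. *)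

(* Defs.v *)
From HB Require Import structures.
From mathcomp Require Import all_boot all_order all_algebra.
From mathcomp Require Import all_classical all_reals all_analysis.

Set Implicit Arguments.
Unset Strict Implicit.
Unset Printing Implicit Defensive.

Import Order.TTheory GRing.Theory Num.Theory.
Import numFieldNormedType.Exports.

Local Open Scope classical_set_scope.
Local Open Scope ring_scope.

(* HB cannot join Order.Lattice ring_display with CompleteNormedModule (the two
   already meet in Num.RealDomain), so the order and the lattice operations are
   fields here and the Order.Lattice instance is derived below.  The modulus of
   x is join x (- x); the last axiom says that the norm is a lattice norm. *)
HB.mixin Record CompleteNormedModule_isBanachLattice (R : realType) V
    of CompleteNormedModule R V := {
  banach_le : rel V ;
  banach_meet : V -> V -> V ;
  banach_join : V -> V -> V ;
  banach_le_refl : reflexive banach_le ;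
  banach_le_anti : antisymmetric banach_le ;
  banach_le_trans : transitive banach_le ;
  banach_meetP : forall x y z,
    banach_le x (banach_meet y z) = banach_le x y && banach_le x z ;
  banach_joinP : forall x y z,
    banach_le (banach_join x y) z = banach_le x z && banach_le y z ;
  banach_leD2r : forall x y z, banach_le x y -> banach_le (x + z) (y + z) ;
  banach_leZ : forall (a : R) x y,
    0 <= a -> banach_le x y -> banach_le (a *: x) (a *: y) ;
  banach_le_norm : forall x y,
    banach_le (banach_join x (- x)) (banach_join y (- y)) -> `|x| <= `|y|
}.

#[short(type="banachLatticeType")]
HB.structure Definition BanachLattice (R : realType) :=
  { V of CompleteNormedModule R V & CompleteNormedModule_isBanachLattice R V }.

#[non_forgetful_inheritance]
HB.instance Definition _ (R : realType) (V : banachLatticeType R) :=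
  Order.Le_isPOrder.Build ring_display (BanachLattice.sort V)
    banach_le_refl banach_le_anti banach_le_trans.
#[non_forgetful_inheritance]
HB.instance Definition _ (R : realType) (V : banachLatticeType R) :=
  Order.POrder_MeetJoin_isLattice.Build ring_display (BanachLattice.sort V)
    banach_meetP banach_joinP.

Section banach_lattice_theory.
Context (R : realType) (V : banachLatticeType R).
Implicit Types (x y z : V) (a : R).

Lemma lerD2r_banach x y z : x <= y -> x + z <= y + z.
Proof. exact: banach_leD2r. Qed.

Lemma ler_wpZ_banach a x y : 0 <= a -> x <= y -> a *: x <= a *: y.
Proof. exact: banach_leZ. Qed.

Lemma ler_norm_modulus x y :
  Order.join x (- x) <= Order.join y (- y) -> `|x| <= `|y|.
Proof. exact: banach_le_norm. Qed.

End banach_lattice_theory.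

Section C0_type.
Context (L : topologicalType) (R : realType).

Definition vanishes_at_infinity (f : L -> R) :=
  forall e : R, 0 < e -> compact [set x | e <= `|f x|].

Definition C0_pred : {pred L -> R} :=
  mem [set f : L -> R | continuous f /\ vanishes_at_infinity f].

Record C0 := MkC0 { C0_fun :> L -> R ; C0_funP : C0_fun \in C0_pred }.

HB.instance Definition _ := [isSub for C0_fun].
HB.instance Definition _ := [Choice of C0 by <:].

Lemma C0_continuous (f : C0) : continuous f.
Proof. by have := C0_funP f; rewrite inE => -[]. Qed.

Lemma C0_vanishes (f : C0) : vanishes_at_infinity f.
Proof. by have := C0_funP f; rewrite inE => -[]. Qed.

Lemma C0_ext (f g : C0) : f =1 g -> f = g.
Proof. by move=> fg; apply/val_inj/funext. Qed.

Lemma closed_norm_ge (f : L -> R) (e : R) :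
  continuous f -> closed [set x | e <= `|f x|].
Proof.
move=> cf.
have cn : continuous (fun x => `|f x|).
  by move=> x; apply: continuous_comp; [exact: cf|exact: norm_continuous].
exact: (continuous_closedP _).1 cn _ (@closed_ge R e).
Qed.

Lemma vanishesW (f g h : L -> R) (k : R) : continuous f ->
  vanishes_at_infinity g -> vanishes_at_infinity h -> 0 < k ->
  (forall x, `|f x| <= k * Num.max `|g x| `|h x|) -> vanishes_at_infinity f.
Proof.
move=> cf vg vh k0 fgh e e0.
have ek0 : 0 < e / k by rewrite divr_gt0.
apply: (subclosed_compact (closed_norm_ge cf) (compactU (vg _ ek0) (vh _ ek0))).
move=> x /= efx; have := le_trans efx (fgh x).
by rewrite mulrC -ler_pdivrMr// le_max => /orP[]; [left|right].
Qed.

Lemma C0_submod_closed : submod_closed C0_pred.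
Proof.
split.
  rewrite inE; split; first exact: cst_continuous.
  move=> e e0; rewrite [X in compact X](_ : _ = set0); first exact: compact0.
  by rewrite -subset0 => x /=; rewrite normr0 leNgt e0.
move=> a f g; rewrite !inE => -[cf vf] [cg vg].
have cfg : continuous (a *: f + g).
  move=> x; apply: (@continuousD R R^o L (a *: f) g); last exact: cg.
  by apply: (@continuousZr _ R^o); exact: cf.
split => //; apply: (@vanishesW _ _ _ (`|a| + 1) cfg vf vg).
  by rewrite ltr_wpDl.
move=> x; rewrite mulrDl mul1r (le_trans (ler_normD _ _))// lerD//.
  by rewrite normrM ler_wpM2l// le_max lexx.
by rewrite le_max lexx orbT.
Qed.

HB.instance Definition _ := GRing.isSubmodClosed.Build R (L -> R) C0_pred
  C0_submod_closed.
HB.instance Definition _ := [SubChoice_isSubLmodule of C0 by <:].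

Definition supnorm (f : C0) : R := sup [set `|f x| | x in [set: L]].

Lemma C0_bounded (f : C0) : has_ubound [set `|f x| | x in [set: L]].
Proof.
have K1 : compact [set x | 1 <= `|f x|] by exact: C0_vanishes.
have /compact_bounded [M [_ MP]] : compact (f @` [set x | 1 <= `|f x|]).
  apply: continuous_compact K1; apply: continuous_subspaceT.
  exact: C0_continuous.
exists (Num.max 1 (`|M| + 1)) => _ [x _ <-]; rewrite le_max.
have [fx1|/ltW -> //] := lerP 1 `|f x|.
apply/orP; right; apply: MP; last by exists x.
by rewrite (le_lt_trans (ler_norm _))// ltrDl.
Qed.

Lemma supnorm_ub (f : C0) x : `|f x| <= supnorm f.
Proof. by apply: ub_le_sup; [exact: C0_bounded|exists x]. Qed.

Lemma supnorm_ge0 (f : C0) : 0 <= supnorm f.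
Proof.
have [/set0P[_ [x _ _]]|/negP/negPn/eqP E] :=
    pselect ([set `|f x| | x in [set: L]] != set0).
  exact: le_trans (supnorm_ub f x).
by rewrite /supnorm E sup0.
Qed.

Lemma supnorm_le (f : C0) (M : R) :
  0 <= M -> (forall x, `|f x| <= M) -> supnorm f <= M.
Proof.
move=> M0 fM.
have [/set0P E|/negP/negPn/eqP E] :=
    pselect ([set `|f x| | x in [set: L]] != set0).
  by apply: ge_sup => // _ [x _ <-].
by rewrite /supnorm E sup0.
Qed.

Lemma supnormD (f g : C0) : supnorm (f + g) <= supnorm f + supnorm g.
Proof.
apply: supnorm_le => [|x]; first by rewrite addr_ge0 ?supnorm_ge0.
by rewrite (le_trans (ler_normD _ _))// lerD ?supnorm_ub.
Qed.

Lemma supnormZ_le (a : R) (f : C0) : supnorm (a *: f) <= `|a| * supnorm f.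
Proof.
apply: supnorm_le => [|x]; first by rewrite mulr_ge0 ?supnorm_ge0.
by rewrite normrM ler_wpM2l// supnorm_ub.
Qed.

Lemma supnormZ (a : R) (f : C0) : supnorm (a *: f) = `|a| * supnorm f.
Proof.
apply/eqP; rewrite eq_le supnormZ_le/=.
have [->|a0] := eqVneq a 0; first by rewrite normr0 mul0r supnorm_ge0.
rewrite -ler_pdivlMl ?normr_gt0// -normfV.
by rewrite -[in leLHS](scalerK a0 f) supnormZ_le.
Qed.

Lemma supnorm_eq0 (f : C0) : supnorm f = 0 -> f = 0.
Proof.
move=> f0; apply: C0_ext => x; apply: normr0_eq0; apply/eqP.
by rewrite eq_le normr_ge0 -{1}f0 supnorm_ub.
Qed.

HB.instance Definition _ :=
  Lmodule_isNormed.Build R C0 supnormD supnormZ supnorm_eq0.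

Lemma C0_normE (f : C0) : `|f| = sup [set `|f x| | x in [set: L]].
Proof. by []. Qed.

Lemma C0_complete (F : set_system C0) : ProperFilter F -> cauchy F -> cvg F.
Proof.
move=> FF /cauchyP Fc.
have {}Fc e : 0 < e -> exists h : C0, \forall g \near F, `|h - g| < e.
  by move=> /Fc[h hP]; exists h; rewrite -ball_normE in hP.
have evB (h g : C0) x : `|h x - g x| <= `|h - g| by exact: supnorm_ub (h - g) x.
have Fx x : cvg ((fun g : C0 => g x) @ F).
  apply: cauchy_cvg; apply: cauchy_exP => e e0.
  have [h hP] := Fc _ e0; exists (h x); rewrite /fmap /=.
  near=> g; rewrite -ball_normE /ball_/= (le_lt_trans (evB _ _ _))//.
  by near: g.
pose f x := lim ((fun g : C0 => g x) @ F).
have fE (h : C0) e : (\forall g \near F, `|h - g| < e) ->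
    forall x, `|h x - f x| <= e.
  move=> hP x; apply/ler_addgt0Pr => d d0; near F => g.
  rewrite -(subrKA (g x)) (le_trans (ler_normD _ _))// lerD//.
    by rewrite (le_trans (evB _ _ _))// ltW//; near: g.
  rewrite distrC ltW//; near: g.
  by move/cvgrPdist_lt: (Fx x); exact.
have cf : continuous f.
  move=> x; apply/cvgrPdist_lt => e e0.
  have e3 : 0 < e / 3 by rewrite divr_gt0.
  have [h /fE hP] := Fc _ e3.
  have /cvgrPdist_lt/(_ _ e3) := @C0_continuous h x.
  apply: filterS => y hxy.
  rewrite -(subrKA (h x)) -(subrKA (h y) (h x)) (le_lt_trans (ler_normD _ _))//.
  have -> : e = e / 3 + (e / 3 + e / 3) by rewrite -!mulrDl -!mulr2n -mulrS -(mulr_natr e) mulfK.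
  apply: ler_ltD; first by rewrite distrC.
  by rewrite (le_lt_trans (ler_normD _ _))// ltr_leD.
have vf : vanishes_at_infinity f.
  move=> e e0; have e2 : 0 < e / 2 by rewrite divr_gt0.
  have [h /fE hP] := Fc _ e2.
  apply: (subclosed_compact (closed_norm_ge cf) (@C0_vanishes h _ e2)).
  move=> x /= efx; rewrite -(lerD2l (e / 2)) -splitr (le_trans efx)//.
  rewrite -[f x](subrK (h x)) (le_trans (ler_normD _ _))// lerD2r distrC.
  exact: hP.
have fP : f \in C0_pred by rewrite inE.
apply/cvg_ex; exists (MkC0 fP); apply/cvgrPdist_lt => e e0.
have e2 : 0 < e / 2 by rewrite divr_gt0.
have [h hF] := Fc _ e2; have hP := fE _ _ hF.
apply: filterS hF => g hg; rewrite -(subrKA h) (le_lt_trans (ler_normD _ _))//.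
rewrite [e in _ < e]splitr ler_ltD//.
by apply: supnorm_le => [|x]; [exact: ltW|rewrite distrC; exact: hP].
Unshelve. all: by end_near. Qed.

HB.instance Definition _ := Uniform_isComplete.Build C0 C0_complete.

Definition C0_le : rel C0 := fun f g => `[< forall x, f x <= g x >].

Lemma C0_leP (f g : C0) : reflect (forall x, f x <= g x) (C0_le f g).
Proof. exact: asboolP. Qed.

Lemma C0_le_refl : reflexive C0_le.
Proof. by move=> f; apply/C0_leP. Qed.

Lemma C0_le_anti : antisymmetric C0_le.
Proof.
move=> f g /andP[/C0_leP fg /C0_leP gf]; apply: C0_ext => x.
by apply/le_anti; rewrite fg gf.
Qed.

Lemma C0_le_trans : transitive C0_le.
Proof.
move=> g f h /C0_leP fg /C0_leP gh; apply/C0_leP => x.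
exact: le_trans (gh x).
Qed.

Lemma C0_meet_subproof (f g : C0) : (f \min g : L -> R) \in C0_pred.
Proof.
rewrite inE.
have cm : continuous (f \min g).
  by move=> x; apply: continuous_min; exact: C0_continuous.
split => //; apply: (@vanishesW _ f g 1) => //; try exact: C0_vanishes.
by move=> x /=; rewrite mul1r minElt; case: ifP; rewrite le_max lexx ?orbT.
Qed.

Lemma C0_join_subproof (f g : C0) : (f \max g : L -> R) \in C0_pred.
Proof.
rewrite inE.
have cm : continuous (f \max g).
  by move=> x; apply: continuous_max; exact: C0_continuous.
split => //; apply: (@vanishesW _ f g 1) => //; try exact: C0_vanishes.
by move=> x /=; rewrite mul1r maxElt; case: ifP; rewrite le_max lexx ?orbT.
Qed.

Definition C0_meet (f g : C0) : C0 := MkC0 (C0_meet_subproof f g).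
Definition C0_join (f g : C0) : C0 := MkC0 (C0_join_subproof f g).

Lemma C0_meetP (f g h : C0) :
  C0_le f (C0_meet g h) = C0_le f g && C0_le f h.
Proof.
apply/C0_leP/andP => [fgh|[/C0_leP fg /C0_leP fh] x].
  by split; apply/C0_leP => x; have := fgh x; rewrite le_min => /andP[].
by rewrite le_min fg fh.
Qed.

Lemma C0_joinP (f g h : C0) :
  C0_le (C0_join f g) h = C0_le f h && C0_le g h.
Proof.
apply/C0_leP/andP => [fgh|[/C0_leP fh /C0_leP gh] x].
  by split; apply/C0_leP => x; have := fgh x; rewrite ge_max => /andP[].
by rewrite ge_max fh gh.
Qed.

Lemma C0_leD2r (f g h : C0) : C0_le f g -> C0_le (f + h) (g + h).
Proof. by move=> /C0_leP fg; apply/C0_leP => x; rewrite lerD2r. Qed.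

Lemma C0_leZ (a : R) (f g : C0) : 0 <= a -> C0_le f g -> C0_le (a *: f) (a *: g).
Proof. by move=> a0 /C0_leP fg; apply/C0_leP => x; rewrite ler_wpM2l. Qed.

Lemma C0_le_norm (f g : C0) :
  C0_le (C0_join f (- f)) (C0_join g (- g)) -> `|f| <= `|g|.
Proof.
move=> /C0_leP fg; apply: supnorm_le => [|x]; first exact: supnorm_ge0.
by apply: le_trans (supnorm_ub g x); have := fg x; rewrite /= !maxrN.
Qed.

HB.instance Definition _ :=
  CompleteNormedModule_isBanachLattice.Build R C0
    C0_le_refl C0_le_anti C0_le_trans C0_meetP C0_joinP
    C0_leD2r C0_leZ C0_le_norm.

HB.instance Definition _ :=
  Order.Lattice.copy C0 (BanachLattice.sort (C0 : banachLatticeType R)).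

Lemma C0_lerP (f g : C0) : reflect (forall x, f x <= g x) (f <= g).
Proof. exact: C0_leP. Qed.

Lemma C0_ler0P (f : C0) : reflect (forall x, 0 <= f x) (0 <= f).
Proof. exact: (C0_lerP 0 f). Qed.

End C0_type.

Section operators.
Context (R : realType) (X Y : banachLatticeType R).

(* The usual operator norm; meaningful for bounded T, the supremum of an
   unbounded set being 0 by convention. *)
Definition opnorm (T : X -> Y) : R := sup [set `|T x| | x in [set x | `|x| <= 1]].

Definition op_sphere (T : {linear X -> Y}) :=
  bounded_fun_norm T /\ opnorm T = 1.

Definition positive_op (T : X -> Y) := forall x, 0 <= x -> 0 <= T x.

Definition BPBp_positive :=
  forall e : R, 0 < e < 1 -> exists2 eta : R, 0 < eta < e &
    forall S : {linear X -> Y}, op_sphere S -> positive_op S ->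
    forall x0 : X, `|x0| = 1 -> `|S x0| > 1 - eta ->
    exists (u0 : X) (T : {linear X -> Y}),
      [/\ `|u0| = 1, op_sphere T, positive_op T &
      [/\ `|T u0| = 1, `|u0 - x0| < e & opnorm (T \- S) < e]].

End operators.
Arguments BPBp_positive {R} X Y.

Section monotonicity.
Context (R : realType) (Y : banachLatticeType R).

Definition strictly_monotone := forall x y : Y,
  0 <= x -> 0 <= y -> x <= y -> x <> y -> `|x| < `|y|.

Definition uniformly_monotone :=
  forall e : R, 0 < e < 1 -> exists2 delta : R, 0 < delta <= e &
    forall x y : Y, 0 <= x -> 0 <= y ->
      `|x| = 1 -> `|x + y| <= 1 + delta -> `|y| <= e.

End monotonicity.
Arguments strictly_monotone {R} Y.
Arguments uniformly_monotone {R} Y.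

(* Main.v *)
From HB Require Import structures.
Require Import Defs.
From mathcomp Require Import all_boot all_order all_algebra.
From mathcomp Require Import all_classical all_reals all_analysis.
From mathcomp Require Import lra.
Import Order.TTheory GRing.Theory Num.Theory.
Import numFieldNormedType.Exports.
Local Open Scope classical_set_scope.
Local Open Scope ring_scope.

(** The idea is to test the Bishop-Phelps-Bollobas property on operators of
    rank at most two.  Let x, y >= 0 in Y with |x| = 1 and |x + y| close to 1,
    and let s, t be distinct points of L.  The operator
    S f = (f(s) x + f(t) y) / |x + y| is positive of norm one, and it almost
    attains its norm at a bump x0 equal to 1 at s and to 0 at t.  So there are
    a positive T of norm one close to S and a unit vector u0 close to x0 at
    which T attains its norm.

    Strict monotonicity enters through [attaining_positive_op_eq0]: a positive
    operator attaining its norm at u0 vanishes on every h >= 0 such that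
    |u0| + h stays in the unit ball, since T |u0| and T (|u0| + h) are
    comparable and both have norm one.  Near t the function |u0| is small, so
    h can be chosen with h(t) close to 1; then T h = 0, while S h is at least
    h(t) y / |x + y|.  As T is close to S, the norm of y is small, with a bound
    that depends only on the closeness of T to S.  The bumps come from the
    complete regularity of locally compact Hausdorff spaces ([C0_bump]). *)

(** * Positive elements and operators of Banach lattices *)

Section banach_lattice.
Context {R : realType} {Y : banachLatticeType R}.
Implicit Types (x y z w : Y) (a b : R).

Lemma subr_ge0_banach x y : (0 <= y - x) = (x <= y).
Proof.
apply/idP/idP => [/(lerD2r_banach x)|/(lerD2r_banach (- x))].
  by rewrite add0r subrK.
by rewrite subrr.
Qed.

Lemma lerD_banach x y z w : x <= y -> z <= w -> x + z <= y + w.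
Proof.
move=> xy zw; apply: (le_trans (lerD2r_banach z xy)).
by rewrite ![y + _]addrC; exact: lerD2r_banach.
Qed.

Lemma addr_ge0_banach x y : 0 <= x -> 0 <= y -> 0 <= x + y.
Proof. by move=> x0 y0; rewrite -[leLHS]addr0; exact: lerD_banach. Qed.

Lemma scaler_ge0_banach a x : 0 <= a -> 0 <= x -> 0 <= a *: x.
Proof. by move=> a0 x0; rewrite -(scaler0 _ a); exact: ler_wpZ_banach. Qed.

Lemma ler_wpZr_banach a b x : 0 <= x -> a <= b -> a *: x <= b *: x.
Proof.
move=> x0 ab; rewrite -subr_ge0_banach -scalerBl scaler_ge0_banach//.
by rewrite subr_ge0.
Qed.

Lemma ler_norm_dominated x y : x <= y -> - x <= y -> `|x| <= `|y|.
Proof.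
move=> xy Nxy; apply: ler_norm_modulus.
by apply: (@le_trans _ _ y); [rewrite leUx xy|exact: leUl].
Qed.

(** Adding the two inequalities gives 0 <= 2 y. *)
Lemma dominating_ge0 x y : x <= y -> - x <= y -> 0 <= y.
Proof.
move=> xy Nxy; have := lerD_banach _ _ _ _ xy Nxy.
rewrite subrr -mulr2n -scaler_nat => y2.
by rewrite -[y](@scalerK _ _ 2%:R) ?pnatr_eq0// scaler_ge0_banach// invr_ge0.
Qed.

Lemma ler_norm_ge0 x y : 0 <= x -> x <= y -> `|x| <= `|y|.
Proof.
move=> x0 xy; apply: ler_norm_dominated => //; apply: le_trans xy.
rewrite -subr_ge0_banach opprK; exact: addr_ge0_banach.
Qed.

End banach_lattice.

Section operators.
Context {R : realType} {X Y : banachLatticeType R}.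
Implicit Types T : {linear X -> Y}.

Lemma ler_opnorm (f : X -> Y) x :
  bounded_fun_norm f -> `|x| <= 1 -> `|f x| <= opnorm f.
Proof.
move=> /(_ 1)[M fM] x1; apply: ub_le_sup; last by exists x.
by exists M => _ [z z1 <-]; exact: fM.
Qed.

Lemma bounded_fun_normB (f g : X -> Y) :
  bounded_fun_norm f -> bounded_fun_norm g -> bounded_fun_norm (f \- g).
Proof.
move=> fb gb r; have [M fM] := fb r; have [N gN] := gb r.
exists (M + N) => x xr; apply: (le_trans (ler_normB _ _)).
by rewrite lerD ?fM ?gN.
Qed.

Lemma op_sphere_le1 T x : op_sphere T -> `|x| <= 1 -> `|T x| <= 1.
Proof. by move=> [bT nT] x1; rewrite -nT; exact: ler_opnorm. Qed.

Lemma positive_op_le T x y : positive_op T -> x <= y -> T x <= T y.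
Proof.
move=> T0 xy; rewrite -subr_ge0_banach -raddfB; apply: T0.
by rewrite subr_ge0_banach.
Qed.

(** T w and T (w + h) are comparable and both have norm one: the first since w
    dominates u, the second since w + h lies in the unit ball.  Strict
    monotonicity makes them equal. *)
Lemma attaining_positive_op_eq0 T u w h : strictly_monotone Y ->
  op_sphere T -> positive_op T -> `|T u| = 1 -> u <= w -> - u <= w ->
  0 <= h -> `|w + h| <= 1 -> T h = 0.
Proof.
move=> mono nT T0 Tu uw Nuw h0 wh1.
have Tw1 : 1 <= `|T w|.
  rewrite -Tu; apply: ler_norm_dominated; first exact: positive_op_le.
  by rewrite -raddfN; exact: positive_op_le.
have Tw0 : 0 <= T w by apply/T0/dominating_ge0; [exact: uw|].
have TwD : T w <= T (w + h).
  by rewrite -subr_ge0_banach -raddfB addrC addKr; exact: T0.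
apply: contrapT => Th0.
have : `|T w| < `|T (w + h)|.
  apply: mono => //; first exact: le_trans TwD.
  by rewrite raddfD => /esym/(congr1 (fun z => - T w + z)); rewrite addKr addNr.
by apply/negP; rewrite -leNgt (le_trans _ Tw1)// op_sphere_le1.
Qed.

End operators.

(** * Bump functions in C_0(L) *)

Section bumps.
Context {R : realType} {L : topologicalType}.
Hypothesis lcL : locally_compact [set: L].
Hypothesis hL : hausdorff_space L.

(** A function separating s from the complement of a relatively compact open
    neighborhood vanishes at infinity, having its support in a compact set. *)
Lemma C0_bump (s : L) (B : set L) : closed B -> ~ B s ->
  exists f : C0 L R,
    [/\ forall x, 0 <= f x <= 1, f s = 1 & forall x, B x -> f x = 0].
Proof.
move=> cB Bs.
have [K sK [cK clK]] := lcL s I.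
have {}sK : nbhs s K by apply: (@filterS _ (nbhs s) _ _ _ _ sK) => z; exact.
have clD : closed (B `|` ~` K°).
  by apply: closedU => //; apply: open_closedC; exact: open_interior.
have Ds : ~ (B `|` ~` K°) s by case.
have /(uniform_separatorP (R := R))[g [cg g01 gs gB]] :=
  @locally_compact_completely_regular L R lcL hL _ _ clD Ds.
have {}g01 x : 0 <= g x <= 1 by have := g01 (g x) (imageT g x); rewrite /= in_itv.
have cf : continuous (fun x => 1 - g x).
  move=> x; apply: (@continuousB R R^o L (cst 1) g); last exact: cg.
  exact: cst_continuous.
have fP : (fun x => 1 - g x) \in @C0_pred L R.
  rewrite inE; split => // e e0.
  apply: (subclosed_compact (closed_norm_ge cf) cK) => x /= ex.
  apply: contrapT => Kx; have gx : g x = 1.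
    by apply: gB; exists x => //; right => /interior_subset.
  by move: ex; rewrite gx subrr normr0 leNgt e0.
exists (MkC0 fP); split => /= [x||x Bx].
- by rewrite subr_ge0 lerBlDr lerDl; have /andP[-> ->] := g01 x.
- by rewrite (gs (g s)) ?subr0//; exists s.
- by rewrite (gB (g x)) ?subrr//; exists x => //; left.
Qed.

Lemma C0_norm_le1 (f : C0 L R) : (forall x, `|f x| <= 1) -> `|f| <= 1.
Proof. by move=> f1; exact: supnorm_le. Qed.

Lemma C0_bump2 (s t : L) : exists f : C0 L R,
  [/\ forall x, 0 <= f x <= 1, f s = 1 & f t = 1].
Proof.
have [f [f01 fs _]] := C0_bump s set0 closed0 (fun F => F).
have [g [g01 gt _]] := C0_bump t set0 closed0 (fun F => F).
exists (C0_join f g); split => [x||] /=.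
- have /andP[f0 f1] := f01 x; have /andP[g0 g1] := g01 x.
  by rewrite le_max f0 ge_max f1.
- by rewrite fs; apply/max_idPl; have /andP[] := g01 s.
- by rewrite gt; apply/max_idPr; have /andP[] := f01 t.
Qed.

End bumps.

(** * Operators carried by two points *)

Section two_point_operator.
Context {R : realType} {Y : banachLatticeType R} {L : topologicalType}.
Variables (s t : L) (a b : Y).

Definition two_point_op (f : C0 L R) : Y := f s *: a + f t *: b.

Lemma two_point_op_linear : linear two_point_op.
Proof.
move=> k f g; rewrite /two_point_op /= !scalerDl scalerDr !scalerA.
by rewrite addrACA.
Qed.

HB.instance Definition _ :=
  GRing.isLinear.Build R (C0 L R) Y *:%R two_point_op two_point_op_linear.

Hypotheses (a0 : 0 <= a) (b0 : 0 <= b).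

Lemma two_point_op_ge0 : positive_op two_point_op.
Proof.
move=> f /C0_ler0P f0.
by apply: addr_ge0_banach; apply: scaler_ge0_banach.
Qed.

Lemma bounded_two_point_op : bounded_fun_norm two_point_op.
Proof.
move=> r; exists (r * `|a| + r * `|b|) => f fr.
apply: (le_trans (ler_normD _ _)).
by rewrite !normrZ lerD// ler_wpM2r// (le_trans (supnorm_ub _ _)).
Qed.

(** On the unit ball the values lie between - (a + b) and a + b, and a + b is
    attained at a function equal to 1 at both points. *)
Lemma op_sphere_two_point_op :
  locally_compact [set: L] -> hausdorff_space L -> `|a + b| = 1 ->
  op_sphere two_point_op.
Proof.
move=> lcL hL ab1; split; first exact: bounded_two_point_op.
apply/eqP; rewrite eq_le; apply/andP; split.
  apply: ge_sup; first by exists `|two_point_op 0|, 0 => //=; rewrite normr0.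
  move=> _ [f /= f1 <-]; rewrite -ab1.
  have {}f1 x : `|f x| <= 1 by exact: le_trans (supnorm_ub _ _) f1.
  have fb c x : 0 <= c :> Y -> f x *: c <= c /\ - (f x *: c) <= c.
    move=> c0; have := f1 x; rewrite ler_norml => /andP[f1l f1r].
    rewrite -scaleNr; split; rewrite -[leRHS]scale1r ler_wpZr_banach//.
    by rewrite lerNl.
  have [sa Nsa] := fb a s a0; have [tb Ntb] := fb b t b0.
  by apply: ler_norm_dominated; rewrite ?opprD lerD_banach.
have [f [f01 fs ft]] := @C0_bump2 R L lcL hL s t.
have -> : 1 = `|two_point_op f| by rewrite /two_point_op fs ft !scale1r.
apply: ler_opnorm; first exact: bounded_two_point_op.
by apply: C0_norm_le1 => x; have /andP[f0 f1] := f01 x; rewrite ger0_norm.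
Qed.

End two_point_operator.

Theorem proposition2p13 (R : realType) (Y : banachLatticeType R)
    (L : topologicalType) :
  strictly_monotone Y ->
  locally_compact [set: L] -> hausdorff_space L ->
  (exists s t : L, s <> t) ->
  BPBp_positive (C0 L R) Y ->
  uniformly_monotone Y.
Proof.
move=> mono lcL hL [s [t st]] bpb e /andP[e0 e1].
have e3 : 0 < e / 3 < 1 by apply/andP; split; lra.
have [eta /andP[eta0 etae] etaP] := bpb _ e3.
exists eta; first by apply/andP; split; lra.
move=> x y x0 y0 x1 xy.
set n := `|x + y| in xy.
have xyx : x <= x + y by rewrite -subr_ge0_banach addrC addKr.
have n1 : 1 <= n by rewrite -x1; exact: ler_norm_ge0.
have n0 : 0 < n by lra.
have ni0 : 0 <= n^-1 by rewrite invr_ge0 ltW.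
pose a := n^-1 *: x; pose b := n^-1 *: y.
have a0 : 0 <= a by exact: scaler_ge0_banach.
have b0 : 0 <= b by exact: scaler_ge0_banach.
have ab1 : `|a + b| = 1.
  by rewrite -scalerDr normrZ (ger0_norm ni0) -/n mulVf// gt_eqF.
have nS := op_sphere_two_point_op s t a b a0 b0 lcL hL ab1.
have t1 : closed [set t].
  exact/accessible_closed_set1/hausdorff_accessible.
have [f [f01 fs ft]] := @C0_bump R L lcL hL s _ t1 st.
have {}ft : f t = 0 by exact: ft.
have f1 : `|f| = 1.
  apply/eqP; rewrite eq_le; apply/andP; split.
    by apply: C0_norm_le1 => z; have /andP[? ?] := f01 z; rewrite ger0_norm.
  by have := supnorm_ub f s; rewrite fs normr1.
have Sf : `|two_point_op s t a b f| > 1 - eta.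
  rewrite /two_point_op fs ft scale0r addr0 scale1r normrZ x1 mulr1.
  rewrite (ger0_norm ni0) -[ltRHS]mul1r ltr_pdivlMr//.
  (* (1 - eta) n <= (1 - eta) (1 + eta) < 1 *)
  by nra.
have S0 := two_point_op_ge0 s t a b a0 b0.
have [u [T [u1 nT T0 [Tu uf TS]]]] := etaP _ nS S0 f f1 Sf.
have [g [g01 gt _]] := @C0_bump R L lcL hL t set0 closed0 (fun F => F).
(* w is the modulus of u; h lifts w to the join of g and w, which is still in
   the unit ball and takes the value 1 at t. *)
pose w := C0_join u (- u).
pose h := C0_join g w - w.
have wE z : w z = `|u z| by rewrite /= maxrN.
have uz z : `|u z| <= 1 by rewrite -u1; exact: supnorm_ub.
have hE z : h z = Num.max (g z) `|u z| - `|u z| by rewrite -wE.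
have h01 z : 0 <= h z <= 1.
  have := uz z; have /andP[g0 g1] := g01 z; rewrite hE => uz1.
  rewrite subr_ge0 le_max lexx orbT /= lerBlDr.
  by rewrite ge_max !ler_wpDr.
have h0 : 0 <= h by apply/C0_ler0P => z; have /andP[] := h01 z.
have ut : `|u t| < e / 3.
  apply: le_lt_trans uf; have : `|u t - f t| <= `|u - f| := supnorm_ub (u - f) t.
  by rewrite ft subr0.
have ht : 1 - e / 3 <= h t.
  by rewrite hE gt lerB// ?le_max ?lexx// ltW.
have Th : T h = 0.
  apply: (attaining_positive_op_eq0 _ u w h mono nT T0 Tu) => //.
  - by apply/C0_lerP => z; rewrite wE ler_norm.
  - by apply/C0_lerP => z; rewrite wE /= -normrN ler_norm.
  rewrite addrC subrK; apply: C0_norm_le1 => z /=.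
  rewrite maxrN ger0_norm; first by rewrite ge_max uz; have /andP[_ ->] := g01 z.
  by rewrite le_max normr_ge0 orbT.
have Sh : `|two_point_op s t a b h| <= e / 3.
  rewrite -normrN -[- _]add0r -Th; apply: le_trans (ltW TS).
  apply: (@ler_opnorm R (C0 L R) Y (T \- two_point_op s t a b)).
    by apply: bounded_fun_normB; [case: nT|case: nS].
  by apply: C0_norm_le1 => z; have /andP[h0z h1z] := h01 z; rewrite ger0_norm.
have : `|h t *: b| <= e / 3.
  apply: le_trans Sh; apply: ler_norm_ge0.
    by apply: scaler_ge0_banach => //; have /andP[] := h01 t.
  rewrite -subr_ge0_banach addrK; apply: scaler_ge0_banach => //.
  by have /andP[] := h01 s.
rewrite !normrZ (ger0_norm ni0) ger0_norm; last by have /andP[] := h01 t.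
rewrite mulrCA mulrC ler_pdivrMr// => yb.
(* (1 - e/3) |y| <= (e/3) (1 + e/3), with 1 - e/3 > 2/3 and 1 + e/3 < 4/3 *)
have := ler_wpM2r (normr_ge0 y) ht.
by have := normr_ge0 y; nra.
Qed.
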